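(* Let $m\in\mathbb{N}\cup\{0\}$ and let $\beta>-m$ be real. Let $R(\beta)\in(0,1)$ be the unique root of the equation $$\frac{1}{\beta+m}-2\sum_{s=m+1}^\infty\frac{1}{\beta+s}\,r^{s-m}=0 .$$ Let $B_X$ be the unit ball of a complex Banach space $X\neq\{0\}$, let $n\ge1$ be an integer, and let $F:B_X\to\overline{\mathbb{D}^n}$ be a holomorphic mapping with $$F(z)=P_m(z)+\sum_{s=m+1}^\infty P_s(z),\qquad z\in B_X,$$ where $P_s(z)=\frac{1}{s!}D^sF(0)(z^s)$. Assume that $\Vert P_m(z)\Vert_\infty$ is constant on $\partial B_X$ and that $|(P_m)_j(z_0)|=\Vert P_m(z_0)\Vert_\infty$ for all $j\in\{1,\dots,n\}$ and all $z_0\in\partial B_X$. Then $$\sum_{s=m}^\infty\frac{\Vert P_s(z)\Vert_\infty}{\beta+s}\le\frac{r^m}{m+\beta}$$ for all $z\in B_X$ with $\Vert z\Vert=r\le R(\beta)$. The number $R(\beta)$ cannot be improved, i.e. (for the given $m$ and $\beta$) for every $R'\in(R(\beta),1)$ there exist a complex Banach space $X\neq\{0\}$, an integer $n\ge1$, a mapping $F:B_X\to\overline{\mathbb{D}^n}$ satisfying all the hypotheses above and a point $z\in B_X$ with $\Vert z\Vert=r\le R'$ for which the inequality fails.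
   Context: $\mathbb{D}=\{z\in\mathbb{C}:|z|<1\}$; $\mathbb{D}^n$ is the open unit polydisc in $\mathbb{C}^n$ and $\overline{\mathbb{D}^n}$ its closure. $\Vert w\Vert_\infty=\max_{1\le j\le n}|w_j|$ for $w\in\mathbb{C}^n$. $B_X=\{x\in X:\Vert x\Vert<1\}$ and $\partial B_X=\{x\in X:\Vert x\Vert=1\}$. $D^sF(0)$ is the $s$-th Fréchet derivative of $F$ at $0$, a symmetric $s$-linear mapping $X^s\to\mathbb{C}^n$, and $D^sF(0)(z^s)$ means $D^sF(0)(z,\dots,z)$; thus $P_s:X\to\mathbb{C}^n$ is an $s$-homogeneous polynomial (defined on all of $X$; $P_0(z)=F(0)$), and $(P_s)_j$ denotes its $j$-th coordinate. Convention: $0^0=1$. *)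

(* Defs.v *)
From HB Require Import structures.
From mathcomp Require Import all_boot all_order all_algebra.
From mathcomp Require Import all_classical all_reals all_analysis.
From mathcomp Require Import complex.

Set Implicit Arguments.
Unset Strict Implicit.
Unset Printing Implicit Defensive.
Import Order.TTheory GRing.Theory Num.Theory.
Import numFieldNormedType.Exports.
Local Open Scope classical_set_scope.
Local Open Scope ring_scope.

(* The library gives an abstract [K : numFieldType] its norm topology; this makes
   that same structure available on the concrete type [R[i]]. *)
HB.instance Definition _ (R : rcfType) := NormedModule.copy R[i] R[i]^o.

Section FrechetDerivatives.
Variables (K : numFieldType) (X Y : normedModType K).

Definition multilinear_map (s : nat) (A : s.-tuple X -> Y) : Prop :=
  forall (v : s.-tuple X) (i : 'I_s),
    linear (fun u : X => A [tuple (if j == i then u else tnth v j) | j < s]).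

Definition bounded_map (s : nat) (A : s.-tuple X -> Y) : Prop :=
  exists M : K, forall v : s.-tuple X,
    `|A v| <= M * \prod_(i < s) `|tnth v i|.

(* [is_frechet_derivative F s x D]: the [s]-th Frechet derivative of [F] at [x]
   exists and is the [s]-linear map [D].  As usual D^(s+1)F(x) is the derivative
   at [x] of y |-> D^sF(y), where the space of bounded [s]-linear maps carries
   the operator norm and L(X, L^s(X, Y)) is identified with L^(s+1)(X, Y), the
   new direction being put in the first slot. *)
Fixpoint is_frechet_derivative (F : X -> Y) (s : nat) (x : X) :
    (s.-tuple X -> Y) -> Prop :=
  match s with
  | 0 => fun D => D [tuple] = F x
  | s'.+1 => fun D =>
      [/\ multilinear_map D,
          bounded_map D
        & exists G : X -> s'.-tuple X -> Y,
            (\forall y \near x, is_frechet_derivative F y (G y)) /\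
            (forall e : K, 0 < e -> \forall h \near (0 : X),
               forall v : s'.-tuple X,
                 `|G (x + h) v - G x v - D [tuple of h :: v]|
                   <= e * `|h| * \prod_(i < s') `|tnth v i|)]
  end.

Definition taylor_term (D : forall s : nat, s.-tuple X -> Y) (s : nat) (z : X)
  : Y := (s`!%:R)^-1 *: D s [tuple z | _ < s].

End FrechetDerivatives.

(* Norms over [R[i]] take their (real) values in [R[i]]; this is the same number
   as an element of [R]. *)
Definition real_norm (R : realType) (V : normedModType R[i]) (x : V) : R :=
  complex.Re `|x|.

(* The norm of ['rV[R[i]]_n] is the maximum norm. *)
Definition polydisc (R : realType) (n : nat) : set 'rV[R[i]]_n :=
  [set w | forall j : 'I_n, `|w ord0 j| < 1].

Definition bohr_radius_eq (R : realType) (m : nat) (beta r : R) : Prop :=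
  (beta + m%:R)^-1
    - 2 * limn (fun N => \sum_(m.+1 <= s < N) (beta + s%:R)^-1 * r ^+ (s - m))
  = 0.

(* [F] is a total function, but only its values on the open unit ball matter. *)
Record bohr_mapping (R : realType) (m n : nat) (X : completeNormedModType R[i])
    (F : X -> 'rV[R[i]]_n) (D : forall s : nat, s.-tuple X -> 'rV[R[i]]_n)
  : Prop := BohrMapping {
  bohr_holomorphic : forall z : X, `|z| < 1 -> differentiable F z;
  bohr_range : forall z : X, `|z| < 1 -> closure (@polydisc R n) (F z);
  bohr_derivatives : forall s : nat, is_frechet_derivative F 0 (D s);
  bohr_expansion : forall z : X, `|z| < 1 ->
    (fun N => taylor_term D m z + \sum_(m.+1 <= s < N) taylor_term D s z)
      @ \oo --> F z;
  bohr_constant_norm : exists c : R[i], forall z : X,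
    `|z| = 1 -> `|taylor_term D m z| = c;
  bohr_coordinates : forall (j : 'I_n) (z0 : X),
    `|z0| = 1 -> `|taylor_term D m z0 ord0 j| = `|taylor_term D m z0|
}.

(* The sum is taken in [\bar R], so the inequality includes convergence. *)
Definition bohr_inequality (R : realType) (m n : nat) (beta : R)
    (X : completeNormedModType R[i])
    (D : forall s : nat, s.-tuple X -> 'rV[R[i]]_n) (z : X) : Prop :=
  (\sum_(m <= s <oo)
      (real_norm (taylor_term D s z) / (beta + s%:R))%:E
    <= (real_norm z ^+ m / (m%:R + beta))%:E)%E.

(* Main.v *)
Require Import Defs.
From HB Require Import structures.
From mathcomp Require Import all_boot all_order all_algebra.
From mathcomp Require Import cyclic cyclotomic separable.
From mathcomp Require Import all_classical all_reals all_analysis.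
From mathcomp Require Import complex.
From mathcomp Require Import ring lra zify.
Set Implicit Arguments.
Unset Strict Implicit.
Unset Printing Implicit Defensive.
Import Order.TTheory GRing.Theory Num.Theory.
Import numFieldNormedType.Exports.
Local Open Scope classical_set_scope.
Local Open Scope ring_scope.

(** Restricting F to a complex line through 0, in the direction of a unit vector
    z0, gives in each coordinate a power series sum_(s >= m) a_s l^s bounded by 1
    on the unit disc. Such a series satisfies |a_s| <= 2 (1 - |a_m|) for s > m, a
    Caratheodory-type inequality obtained here by averaging over roots of unity
    on circles of radius r < 1 and letting r tend to 1: see [coef_bound_roots]
    and [power_series_coef_bound]. Since all coordinates of P_m(z0) have the same
    modulus c, it follows that |P_s(z0)| <= 2 (1 - c) for s > m. Hence for z = r z0
    the weighted sum is at most
      r^m (c / (beta + m) + (1 - c) 2 sum_(k >= 1) r^k / (beta + m + k)),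
    and for r <= R(beta) twice the last sum is at most 1 / (beta + m), which
    makes the total at most r^m / (beta + m) ([bohr_inequality_of_radius]).

    The radius exists and is unique because r |-> sum_(k >= 1) r^k / (b + k) is
    continuous and strictly increasing on [0, 1), vanishes at 0, and is unbounded
    near 1 as the harmonic series diverges ([ex_bohr_radius], [bohr_sum_lim_lt]).

    It is optimal already for X the complex plane and n = 1, with
    F(z) = z^m (a - z) / (1 - a z), 0 < a < 1, whose coefficients have modulus a
    and then (1 - a^2) a^(k-1) for k >= 1. At |z| = r the inequality then amounts to
      (1 + a) sum_(k >= 1) a^(k-1) r^k / (b + k) <= 1 / b,
    and for r > R(beta) it fails once a is close to 1 ([blaschke_not_bohr]).
    Writing F as a polynomial plus a multiple of 1 / (1 - a z) gives all its
    derivatives in closed form. *)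

(** * A coefficient inequality from roots of unity *)

Lemma ex_prim_root (C : numClosedFieldType) (M : nat) :
  (0 < M)%N -> exists w : C, M.-primitive_root w.
Proof.
move=> M0; have [r Dr] := closed_field_poly_normal ('X^M - 1 : {poly C}).
rewrite (monicP (monicXnsubC _ M0)) scale1r in Dr.
have szr : size r = M.
  by apply: succn_inj; rewrite -(size_prod_XsubC r id) -Dr size_XnsubC.
have r1 : all M.-unity_root r by apply/allP=> z; rewrite -root_prod_XsubC -Dr.
have ur : uniq r.
  by rewrite -separable_prod_XsubC -Dr separable_Xn_sub_1 // pnatr_eq0 -lt0n.
have /hasP[w _ pw] : has M.-primitive_root r.
  by apply: has_prim_root => //; rewrite szr.
by exists w.
Qed.

Lemma norm_prim_root (C : numClosedFieldType) (M : nat) (w : C) :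
  M.-primitive_root w -> `|w| = 1.
Proof.
move=> pw; apply/eqP.
rewrite -(@pexpr_eq1 _ _ M) ?(prim_order_gt0 pw) ?normr_ge0 //.
by rewrite -normrX (prim_expr_order pw) normr1.
Qed.

Lemma sum_prim_root (C : numClosedFieldType) (M j : nat) (w : C) :
  M.-primitive_root w ->
  \sum_(i < M) (w ^+ i) ^+ j = if (M %| j)%N then M%:R else 0.
Proof.
move=> pw; have -> : \sum_(i < M) (w ^+ i) ^+ j = \sum_(i < M) (w ^+ j) ^+ i.
  by apply: eq_bigr => i _; rewrite -!exprM mulnC.
rewrite (prim_order_dvd pw); case: eqP => [->|/eqP wj].
  by rewrite (eq_bigr (fun=> 1)) ?sumr_const ?card_ord // => i; rewrite expr1n.
rewrite -subr_eq0 in wj; apply: (mulfI wj).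
by rewrite -subrX1 -exprM mulnC exprM (prim_expr_order pw) expr1n subrr mulr0.
Qed.

(** Rotating y onto the direction of x turns the triangle inequality into an
    equality. *)
Lemma ex_align (C : numClosedFieldType) (x y : C) :
  exists2 u : C, `|u| = 1 & `|x + u * y| = `|x| + `|y|.
Proof.
have [->|x0] := eqVneq x 0.
  by exists 1; rewrite ?normr1 // mul1r normr0 !add0r.
have [->|y0] := eqVneq y 0.
  by exists 1; rewrite ?normr1 // mulr0 normr0 !addr0.
have nx : `|x| != 0 by rewrite normr_eq0.
have ny : `|y| != 0 by rewrite normr_eq0.
exists (x / `|x| * (`|y| / y)).
  by rewrite !normrM !normfV !normr_id divff // divff // mulr1.
have -> : x + x / `|x| * (`|y| / y) * y = x / `|x| * (`|x| + `|y|).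
  by field; rewrite nx y0.
by rewrite normrM normf_div normr_id divff // mul1r ger0_norm // addr_ge0.
Qed.

(** A discrete Caratheodory inequality. Average g(w^i) = sum_j b_j w^(ij)
    against the nonnegative weights |1 + u conj(w^(ik))|^2, where |u| = 1. The
    weights have mean 2, so the mean of their product with g has modulus at
    most 2A, and by orthogonality of the characters that mean is
    2 b_0 + u b_k. Choosing u so that the two terms align gives the bound. *)
Lemma coef_bound_roots (C : numClosedFieldType) (n k M : nat) (b : nat -> C)
    (w A : C) :
  M.-primitive_root w -> (0 < k < n)%N -> (n + k <= M)%N ->
  (forall i : 'I_M, `|\sum_(j < n) b j * (w ^+ i) ^+ j| <= A) ->
  2 * `|b 0%N| + `|b k| <= 2 * A.
Proof.
move=> pw /andP[k0 kn] nkM hA.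
have M0 := prim_order_gt0 pw.
have [u u1 hu] := ex_align (2 * b 0%N) (b k).
(* Negative-frequency moments of g vanish since n + k <= M leaves no aliasing,
   so averaging g against W only sees b 0 and b k. *)
pose g (i : 'I_M) := \sum_(j < n) b j * (w ^+ i) ^+ j.
pose x (i : 'I_M) := (w ^+ i) ^+ k.
have x1 i : `|x i| = 1 by rewrite !normrX (norm_prim_root pw) !expr1n.
have xV i : (x i)^* = (w ^+ i) ^+ (M - k).
  have x0 : x i != 0 by rewrite -normr_eq0 x1 oner_eq0.
  have := normCK (x i); rewrite x1 expr1n => e; apply: (mulfI x0).
  rewrite -e -exprD subnKC ?(leq_trans (ltnW kn)) ?(leq_trans _ nkM) ?leq_addr //.
  by rewrite -exprM mulnC exprM (prim_expr_order pw) expr1n.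
pose W (i : 'I_M) : C := `|1 + u * (x i)^*| ^+ 2.
have WE i : W i = 2 + u * (w ^+ i) ^+ (M - k) + u^* * (w ^+ i) ^+ k.
  have -> : W i = 1 + u * (x i)^* + u^* * x i + `|u| ^+ 2 * `|x i| ^+ 2.
    rewrite /W; move: (x i) => y; rewrite !normCK rmorphD rmorph1 rmorphM /=.
    by rewrite conjCK; ring.
  by rewrite u1 x1 !expr1n xV -/(x i); ring.
have W0 i : 0 <= W i by rewrite exprn_ge0.
have Mk : (M %| M - k)%N = false.
  rewrite gtnNdvd ?subn_gt0 ?ltn_subrL ?k0 ?M0 //.
  by apply: leq_trans nkM; rewrite -[X in (X < _)%N]add0n ltn_add2r (leq_trans _ kn).
have kM : (k < M)%N by apply: leq_trans nkM; apply: (leq_trans kn); rewrite leq_addr.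
have sumW : \sum_i W i = 2 * M%:R.
  under eq_bigr do rewrite WE.
  rewrite !big_split /= -!mulr_sumr !(sum_prim_root _ pw) Mk gtnNdvd // !mulr0 !addr0.
  by rewrite !sumr_const card_ord; ring.
have sumWg : \sum_i W i * g i = M%:R * (2 * b 0%N + u * b k).
  have mom t : \sum_(i < M) (w ^+ i) ^+ t * g i
      = \sum_(j < n) b j * (if (M %| t + j)%N then M%:R else 0).
    under eq_bigr do rewrite mulr_sumr.
    rewrite exchange_big /=; apply: eq_bigr => j _.
    by rewrite -(sum_prim_root _ pw) mulr_sumr; apply: eq_bigr => i _; rewrite exprD; ring.
  have n0 : (0 < n)%N by apply: leq_ltn_trans kn.
  have -> : \sum_i W i * g i = 2 * (\sum_(i < M) (w ^+ i) ^+ 0 * g i)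
      + u * (\sum_(i < M) (w ^+ i) ^+ (M - k) * g i) + u^* * (\sum_(i < M) (w ^+ i) ^+ k * g i).
    rewrite !mulr_sumr -!big_split; apply: eq_bigr => i _ /=; rewrite WE expr0; ring.
  rewrite !mom.
  rewrite (bigD1 (Ordinal n0)) //= dvdn0 big1 => [|j j0]; last first.
    rewrite add0n gtnNdvd ?mulr0 ?lt0n //.
    by apply: leq_trans nkM; rewrite ltn_addr.
  rewrite (bigD1 (Ordinal kn)) //= subnK ?(ltnW kM) // dvdnn big1 => [|j jk]; last first.
    case: ifP; rewrite ?mulr0 // => /dvdnP[q hq]; exfalso.
    move: jk; rewrite -val_eqE /= => /eqP jk.
    have := ltn_ord j; case: q hq => [|[|q]]; nia.
  rewrite big1 => [|j _]; last first.
    rewrite gtnNdvd ?mulr0 ?addn_gt0 ?k0 //.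
    by apply: leq_trans nkM; rewrite addnC ltn_add2r.
  by ring.
have : `|M%:R * (2 * b 0%N + u * b k)| <= M%:R * (2 * A).
  rewrite -sumWg (le_trans (ler_norm_sum _ _ _)) //.
  have -> : M%:R * (2 * A) = \sum_i W i * A by rewrite -mulr_suml sumW; ring.
  apply: ler_sum => i _; rewrite normrM ger0_norm ?W0 //.
  by apply: ler_wpM2l; rewrite ?W0 ?hA.
rewrite normrM normr_nat ler_pM2l ?ltr0n // hu normrM normr_nat.
by [].
Qed.

(** * Coefficients of bounded power series *)

Lemma real_normE (R : realType) (V : normedModType R[i]) (x : V) :
  `|x| = ((real_norm x)%:C)%C.
Proof.
by have := ger0_Im (normr_ge0 x); rewrite /real_norm; case: (`|x|) => a b /= ->.
Qed.

Lemma real_norm_ge0 (R : realType) (V : normedModType R[i]) (x : V) :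
  0 <= real_norm x.
Proof. by rewrite -ler0c -real_normE. Qed.

Lemma gt0_complexE (R : realType) (e : R[i]) :
  0 < e -> e = ((complex.Re e)%:C)%C.
Proof. by move=> e0; have := ger0_Im (ltW e0); case: (e) => x y /= ->. Qed.

Lemma geometric_tail_le (R : realFieldType) (q : R) (N K : nat) :
  0 <= q < 1 -> \sum_(N <= s < K) q ^+ s <= q ^+ N / (1 - q).
Proof.
move=> /andP[q0 q1]; have q1' : 0 < 1 - q by rewrite subr_gt0.
rewrite ler_pdivlMr // mulr_suml; have [NK|KN] := leqP N K; last first.
  by rewrite big_geq ?exprn_ge0 // ltnW.
rewrite (eq_bigr (fun s => - (q ^+ s.+1 - q ^+ s))); last first.
  by move=> s _; rewrite exprS; ring.
by rewrite sumrN telescope_sumr // opprB lerBlDr lerDl exprn_ge0.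
Qed.

(** Convergence at one larger radius r' bounds the terms there, so on the circle
    of radius r the terms decay like (r / r')^s, uniformly in the argument of
    l. Uniformity is what allows the number of sample points on the circle to
    depend on the truncation order. *)
Lemma power_series_uniform (R : realType) (m : nat) (a : nat -> R[i])
    (f : R[i] -> R[i]) (r e : R) :
  (forall l : R[i], `|l| < 1 ->
     (fun N => \sum_(0 <= s < N) a s * l ^+ (m + s)) @ \oo --> f l) ->
  0 < r < 1 -> 0 < e ->
  \forall N \near \oo, forall l : R[i], `|l| = (r%:C)%C ->
    `|f l - \sum_(0 <= s < N) a s * l ^+ (m + s)| <= (e%:C)%C.
Proof.
move=> cvf /andP[r0 r1] e0.
pose r' := (1 + r) / 2; have r'0 : 0 < r' by rewrite /r'; lra.
have r'1 : r' < 1 by rewrite /r'; lra.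
have rr' : r < r' by rewrite /r'; lra.
pose q := r / r'.
have q0 : 0 < q by rewrite divr_gt0.
have q1 : q < 1 by rewrite ltr_pdivrMr // mul1r.
have nr' : `|(r'%:C)%C : R[i]| = (r'%:C)%C by rewrite ger0_norm // ler0c ltW.
have r'1C : `|(r'%:C)%C : R[i]| < 1 by rewrite nr' -[1]/((1%:C)%C) ltcR.
have [B B0 hB] : exists2 B : R, 0 < B &
    forall s, `|a s| * ((r'%:C)%C) ^+ (m + s) <= (B%:C)%C.
  have /cvgP/cvg_seq_bounded := cvf _ r'1C.
  move=> [B0 [_ /(_ (B0 + 1))]]; rewrite ltrDl ltr01 => /(_ isT) hB.
  have {}hB t : `|\sum_(0 <= s < t) a s * (r'%:C)%C ^+ (m + s)|
      <= ((real_norm (B0 + 1))%:C)%C.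
    by rewrite -real_normE (le_trans (hB t I)) // real_ler_norm // ger0_real //
      (le_trans (normr_ge0 _) (hB t I)).
  exists (2 * real_norm (B0 + 1) + 1).
    by rewrite ltr_wpDl // mulr_ge0 // real_norm_ge0.
  move=> s; rewrite -nr' -normrX -normrM.
  have -> : a s * (r'%:C)%C ^+ (m + s) =
      \sum_(0 <= t < s.+1) a t * (r'%:C)%C ^+ (m + t) -
      \sum_(0 <= t < s) a t * (r'%:C)%C ^+ (m + t).
    by rewrite big_nat_recr //= [in RHS]addrAC subrr add0r.
  rewrite (le_trans (ler_normB _ _)) // (le_trans (lerD (hB _) (hB _))) //.
  by rewrite -rmorphD lecR; lra.
have [c c0 hc] : exists2 c : R, 0 < c & B * (c / (1 - q)) <= e / 2.
  exists (e / 2 / B * (1 - q)).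
    by rewrite !mulr_gt0 ?invr_gt0 // subr_gt0.
  by rewrite mulfK ?subr_eq0 ?gt_eqF // mulrC divfK ?gt_eqF.
have : (fun N => q ^+ N) @ \oo --> (0 : R).
  by apply: cvg_expr; rewrite ger0_norm // ltW.
move=> /cvgrPdist_le /(_ _ c0); apply: filterS => N.
rewrite sub0r normrN ger0_norm ?exprn_ge0 ?(ltW q0) // => qN l lr.
have l1 : `|l| < 1 by rewrite lr -[1]/((1%:C)%C) ltcR.
have e2 : 0 < ((e / 2)%:C)%C :> R[i] by rewrite ltcR divr_gt0.
have /cvgrPdist_le/(_ _ e2) := cvf _ l1.
have : \forall K \near \oo, (N <= K)%N by exists N.
move=> hK1 hK2; near \oo => K.
have NK : (N <= K)%N by near: K.
have fK : `|f l - \sum_(0 <= s < K) a s * l ^+ (m + s)| <= ((e / 2)%:C)%C.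
  by near: K.
rewrite (big_cat_nat _ NK) //= in fK.
set S := \sum_(0 <= s < N) _ in fK *; set T := \sum_(N <= s < K) _ in fK.
have -> : f l - S = (f l - (S + T)) + T by ring.
rewrite (le_trans (ler_normD _ _)) // [e]splitr rmorphD lerD //.
rewrite (le_trans (ler_norm_sum _ _ _)) //.
have term s : `|a s * l ^+ (m + s)| <= ((B * q ^+ s)%:C)%C.
  have -> : ((B * q ^+ s)%:C = (B%:C)%C * ((q ^+ s)%:C)%C :> R[i])%C.
    exact: rmorphM.
  have -> : a s * l ^+ (m + s) =
      a s * (r'%:C)%C ^+ (m + s) * (l / (r'%:C)%C) ^+ (m + s).
    by rewrite -mulrA -exprMn [_ * (l / _)]mulrC divfK // gt_eqF // ltcR.
  rewrite normrM; apply: ler_pM => //; first by rewrite normrM !normrX nr'.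
  rewrite normrX normrM normfV nr' lr -fmorphV -rmorphM -rmorphXn lecR.
  by rewrite exprD ler_piMl ?exprn_ge0 ?exprn_ile1 ?(ltW q0) ?(ltW q1).
rewrite (le_trans (ler_sum _ (fun s _ => term s))) //.
rewrite -rmorph_sum lecR -mulr_sumr (le_trans _ hc) // ler_pM2l //.
rewrite (le_trans (geometric_tail_le _ _ _)) ?q1 ?(ltW q0) //.
by rewrite ler_pM2r // invr_gt0 subr_gt0.
Unshelve. all: by end_near.
Qed.

Lemma le_of_expr_lt1 (R : realType) (n : nat) (x c : R) :
  (forall r, 0 < r < 1 -> r ^+ n * x <= c) -> x <= c.
Proof.
move=> h; have : (fun r : R => r ^+ n * x) @ (1 : R)^'- --> (1 : R) ^+ n * x.
  by apply: cvgMl; apply: cvg_at_left_filter; exact: exprn_continuous.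
rewrite expr1n mul1r => cvx; apply: (cvgr_to_le cvx).
near=> r; apply: h; apply/andP; split; near: r.
  by apply: nbhs_left_gt; exact: ltr01.
exact: nbhs_left_lt.
Unshelve. all: by end_near.
Qed.

(** On |l| = r the truncations of sum_s a_s l^s have modulus at most
    (1 + e) / r^m up to a vanishing error, so the discrete inequality applies to
    the coefficients a_s r^s. Letting e tend to 0 and then r tend to 1 removes
    the factor l^m without any maximum principle. *)
Lemma power_series_coef_bound (R : realType) (m k : nat) (a : nat -> R[i])
    (f : R[i] -> R[i]) :
  (forall l : R[i], `|l| < 1 ->
     (fun N => \sum_(0 <= s < N) a s * l ^+ (m + s)) @ \oo --> f l) ->
  (forall l : R[i], `|l| < 1 -> `|f l| <= 1) ->
  (0 < k)%N -> 2 * `|a 0%N| + `|a k| <= 2.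
Proof.
move=> cvf f1 k0.
have twoC : (2 : R[i]) = (2%:C)%C by rewrite rmorph_nat.
rewrite !real_normE twoC -rmorphM -rmorphD lecR.
apply: (@le_of_expr_lt1 _ (m + k)) => r r01; apply/ler_addgt0Pr => e e0.
have /andP[r0 r1] := r01.
have e20 : 0 < e / 2 by rewrite divr_gt0.
have := power_series_uniform cvf r01 e20 => uf.
have : \forall N \near \oo, (k < N)%N by exists k.+1.
move=> kN1; near \oo => N.
have kN : (k < N)%N by near: N.
have ufN : forall l : R[i], `|l| = (r%:C)%C ->
   `|f l - \sum_(0 <= s < N) a s * l ^+ (m + s)| <= ((e / 2)%:C)%C by near: N.
(* N + k sample points separate the frequencies from - k to N - 1. *)
have M0 : (0 < N + k)%N by rewrite addn_gt0 k0 orbT.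
have [w pw] := ex_prim_root R[i] M0.
have rC : `|(r%:C)%C : R[i]| = (r%:C)%C by rewrite ger0_norm // ler0c ltW.
have rm0 : 0 < r ^+ m by rewrite exprn_gt0.
have k0N : (0 < k < N)%N by rewrite k0.
have hA (i : 'I_(N + k)) : `|\sum_(j < N) a j * (r%:C)%C ^+ j * (w ^+ i) ^+ j|
    <= (((1 + e / 2) / r ^+ m)%:C)%C.
  pose l := (r%:C)%C * w ^+ i.
  have lr : `|l| = (r%:C)%C.
    by rewrite normrM rC normrX (norm_prim_root pw) expr1n mulr1.
  have l1 : `|l| < 1 by rewrite lr -[1]/((1%:C)%C) ltcR.
  have -> : (((1 + e / 2) / r ^+ m)%:C)%C = ((1 + e / 2)%:C)%C / `|l ^+ m|.
    by rewrite rmorphM fmorphV rmorphXn normrX lr.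
  rewrite ler_pdivlMr; last by rewrite normrX lr exprn_gt0 // ltcR.
  rewrite -normrM mulr_suml.
  have -> : \sum_(j < N) a j * (r%:C)%C ^+ j * (w ^+ i) ^+ j * l ^+ m =
      f l - (f l - \sum_(0 <= s < N) a s * l ^+ (m + s)).
    rewrite opprB addrC subrK big_mkord; apply: eq_bigr => j _.
    rewrite exprD [l ^+ j]exprMn. ring.
  rewrite (le_trans (ler_normB _ _)) // rmorphD lerD ?f1 //.
  exact: ufN.
have := @coef_bound_roots _ _ _ _ (fun j => a j * (r%:C)%C ^+ j) _ _ pw k0N
  (leqnn _) hA; rewrite expr0 mulr1.
rewrite normrM normrX rC !real_normE twoC -rmorphXn -!rmorphM -rmorphD lecR.
rewrite mulrA ler_pdivlMr // => H; have -> : 2 + e = 2 * (1 + e / 2) by field.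
apply: le_trans H.
rewrite [leRHS]mulrC exprD -mulrA ler_pM2l // mulrDr [r ^+ k * real_norm _]mulrC lerD2r.
by rewrite ler_piMl ?exprn_ile1 ?(ltW r0) ?(ltW r1) // mulr_ge0 // real_norm_ge0.
Unshelve. all: by end_near.
Qed.

(** * Homogeneous terms on complex lines *)

(** The arguments are scaled one slot at a time, each slot contributing one
    factor l. *)
Lemma multilinear_scale (K : numFieldType) (X Y : normedModType K) (s : nat)
    (A : s.-tuple X -> Y) (l : K) (z : X) :
  multilinear_map A -> A [tuple l *: z | _ < s] = l ^+ s *: A [tuple z | _ < s].
Proof.
move=> linA.
have step k : (k <= s)%N ->
    A [tuple (if (j < k)%N then l *: z else z) | j < s]
    = l ^+ k *: A [tuple z | _ < s].
  elim: k => [_|k IH ks].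
    rewrite expr0 scale1r; apply: (congr1 A).
    by apply: eq_from_tnth => j; rewrite !tnth_mktuple.
  pose v : s.-tuple X := [tuple (if (j < k)%N then l *: z else z) | j < s].
  pose B u := A [tuple (if j == Ordinal ks then u else tnth v j) | j < s].
  have linB : linear B by exact: linA.
  have B0 : B 0 = 0.
    by have := linB (-1) 0 0; rewrite scaler0 addr0 scaleN1r addNr.
  have -> : [tuple (if (j < k.+1)%N then l *: z else z) | j < s] =
      [tuple (if j == Ordinal ks then l *: z else tnth v j) | j < s].
    apply: eq_from_tnth => j; rewrite !tnth_mktuple -val_eqE /= ltnS leq_eqVlt.
    by case: eqP.
  rewrite -/(B (l *: z)) -[l *: z]addr0 linB B0 addr0 exprS -scalerA -IH 1?ltnW //.
  congr (_ *: _); apply: (congr1 A); apply: eq_from_tnth => j; rewrite !tnth_mktuple -val_eqE /=.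
  by case: eqP => [->|//]; rewrite ltnn.
rewrite -step //; apply: (congr1 A).
by apply: eq_from_tnth => j; rewrite !tnth_mktuple ltn_ord.
Qed.

Lemma taylor_term_scale (K : numFieldType) (X Y : normedModType K)
    (F : X -> Y) (x : X) (D : forall s : nat, s.-tuple X -> Y) (s : nat)
    (l : K) (z : X) :
  is_frechet_derivative F x (D s) ->
  taylor_term D s (l *: z) = l ^+ s *: taylor_term D s z.
Proof.
rewrite /taylor_term scalerA mulrC -scalerA; case: s => [|s] DF.
  by rewrite expr0 scale1r; congr (_ *: D _ _); rewrite [LHS]tuple0 [RHS]tuple0.
by congr (_ *: _); apply: multilinear_scale; case: DF.
Qed.

Lemma norm_coord_le (K : numDomainType) (m n : nat) (M : 'M[K]_(m, n)) i j :
  `|M i j| <= `|M|.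
Proof.
rewrite [`|M|]mx_normE.
change (`|M i j|%:nng%:num <= (\big[Num.max/0%:nng]_i0 `|M i0.1 i0.2|%:nng)%:num).
rewrite num_le; exact: (le_bigmax _ (fun i : 'I_m * 'I_n => `|M i.1 i.2|%:nng) (i, j)).
Qed.

Lemma norm_mx_le (K : numDomainType) (m n : nat) (M : 'M[K]_(m, n)) (c : K) :
  0 <= c -> (forall i j, `|M i j| <= c) -> `|M| <= c.
Proof.
move=> c0 hc; have [->|/mx_norm_neq0[[i j] /= e]] := eqVneq (`|M|) 0; first by [].
by rewrite [`|M|]e.
Qed.

Lemma closure_polydisc_le (R : realType) (n : nat) (w : 'rV[R[i]]_n) (j : 'I_n) :
  closure (@polydisc R n) w -> `|w ord0 j| <= 1.
Proof.
move=> cw; apply/ler_addgt0Pr => e e0.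
have [v [dv]] := cw _ (nbhsx_ballx w e e0).
rewrite -ball_normE /= => wv.
have -> : w ord0 j = (w - v) ord0 j + v ord0 j by rewrite !mxE subrK.
rewrite (le_trans (ler_normD _ _)) // addrC lerD ?(ltW (dv j)) //.
by rewrite (le_trans (norm_coord_le _ _ _)) // ltW.
Qed.

Lemma cvg_coord (R : realType) (n : nat) (u : nat -> 'rV[R[i]]_n)
    (w : 'rV[R[i]]_n) (j : 'I_n) :
  u @ \oo --> w -> (fun N => u N ord0 j) @ \oo --> w ord0 j.
Proof.
move=> /cvgrPdist_le cu; apply/cvgrPdist_le => e /cu; apply: filterS => N.
apply: le_trans; apply: le_trans (norm_coord_le _ ord0 j).
by rewrite !mxE.
Qed.

(** Along the complex line through z0, each coordinate of F is a power series in
    one variable bounded by 1 on the disc, with coefficients (P_s)_j(z0). All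
    coordinates of P_m(z0) have the same modulus, hence the coordinatewise
    bounds combine into a bound on the maximum norms. *)
Lemma bohr_homogeneous_bound (R : realType) (m n k : nat)
    (X : completeNormedModType R[i]) (F : X -> 'rV[R[i]]_n)
    (D : forall s : nat, s.-tuple X -> 'rV[R[i]]_n) (z0 : X) :
  (0 < n)%N -> bohr_mapping m F D -> `|z0| = 1 -> (0 < k)%N ->
  2 * `|taylor_term D m z0| + `|taylor_term D (m + k) z0| <= 2.
Proof.
move=> n0 FD z01 k0.
have coordb (j : 'I_n) : 2 * `|taylor_term D m z0|
    + `|taylor_term D (m + k) z0 ord0 j| <= 2.
  have -> : `|taylor_term D m z0| = `|taylor_term D (m + 0) z0 ord0 j|.
    by rewrite addn0 (bohr_coordinates FD).
  pose a s := taylor_term D (m + s) z0 ord0 j.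
  have lz (l : R[i]) : `|l| < 1 -> `|l *: z0| < 1 by rewrite normrZ z01 mulr1.
  apply: (@power_series_coef_bound _ m k a (fun l => F (l *: z0) ord0 j)) => //.
    move=> l /lz l1; have := cvg_coord (j := j) (bohr_expansion FD l1).
    rewrite -(cvg_shiftn m.+1) => cv; rewrite -(cvg_shiftn 1).
    apply: cvg_trans cv; apply: near_eq_cvg; near=> N => /=.
    have coordE s :
        taylor_term D s (l *: z0) ord0 j = taylor_term D s z0 ord0 j * l ^+ s.
      rewrite (taylor_term_scale l z0 (@bohr_derivatives _ _ _ _ _ _ FD s)).
      by rewrite mxE mulrC.
    rewrite mxE summxE coordE addn1 big_nat_recl // /a !addn0.
    congr (_ + _); rewrite -{1}[m.+1]add0n big_addn addnK.
    by apply: eq_bigr => s _; rewrite coordE addnS addnC -addnS.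
  by move=> l /lz l1; apply: closure_polydisc_le; exact: (bohr_range FD).
rewrite addrC -lerBrDr; apply: norm_mx_le => [|i j].
  have := coordb (Ordinal n0); rewrite addrC -lerBrDr; exact: le_trans.
by rewrite (ord1 i) lerBrDr addrC.
Unshelve. all: by end_near.
Qed.

Lemma addr_natr_gt0 (R : realType) (m s : nat) (beta : R) :
  - m%:R < beta -> (m <= s)%N -> 0 < beta + s%:R.
Proof.
by move=> hb ms; rewrite -[X in X < _](addNr (m%:R : R)) ltr_leD // ler_nat.
Qed.

(** With p = |P_m(z0)| and z = r z0, every later term is at most
    2 (1 - p) r^s / (beta + s). The hypothesis on Rb says that these terms add
    up to at most (1 - p) r^m / (beta + m), which is exactly what the leading
    term p r^m / (beta + m) leaves available. *)
Lemma bohr_inequality_of_radius (R : realType) (m n : nat) (beta Rb : R)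
    (X : completeNormedModType R[i]) (F : X -> 'rV[R[i]]_n)
    (D : forall s : nat, s.-tuple X -> 'rV[R[i]]_n) (z : X) :
  - m%:R < beta -> 0 < Rb ->
  (forall N : nat, 2 * (\sum_(m.+1 <= s < N) (beta + s%:R)^-1 * Rb ^+ (s - m))
     <= (beta + m%:R)^-1) ->
  (exists x : X, x != 0) -> (0 < n)%N -> bohr_mapping m F D ->
  real_norm z <= Rb -> bohr_inequality m beta D z.
Proof.
move=> hbeta Rb0 hRb [x x0] n0 FD zRb.
set r := real_norm z.
have r0 : 0 <= r by exact: real_norm_ge0.
have b0 s : (m <= s)%N -> 0 < beta + s%:R by exact: addr_natr_gt0.
have [z0 z01 zE] : exists2 z0 : X, `|z0| = 1 & z = (r%:C)%C *: z0.
  (* At z = 0 any direction serves; X <> 0 provides one. *)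
  have [z_0|zn0] := eqVneq z 0.
    exists (`|x|^-1 *: x).
      by rewrite normrZ normfV normr_id mulVf // normr_eq0.
    by rewrite /r /real_norm z_0 normr0 scale0r.
  exists (`|z|^-1 *: z); first by rewrite normrZ normfV normr_id mulVf // normr_eq0.
  by rewrite -real_normE scalerA divff ?normr_eq0 // scale1r.
pose p s := real_norm (taylor_term D s z0).
have p0 s : 0 <= p s by exact: real_norm_ge0.
have pE s : real_norm (taylor_term D s z) = r ^+ s * p s.
  apply: complexI; rewrite -real_normE zE.
  rewrite (taylor_term_scale _ z0 (@bohr_derivatives _ _ _ _ _ _ FD s)).
  rewrite normrZ normrX ger0_norm ?ler0c // real_normE.
  by rewrite -rmorphXn -rmorphM.
have pb k : (0 < k)%N -> 2 * p m + p (m + k)%N <= 2.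
  move=> k0; have := bohr_homogeneous_bound n0 FD z01 k0.
  have twoC : (2 : R[i]) = (2%:C)%C by rewrite rmorph_nat.
  by rewrite !real_normE twoC -rmorphM -rmorphD lecR.
have pm1 : p m <= 1.
  rewrite -(@ler_pM2l _ 2) // mulr1; apply: le_trans (pb 1%N isT).
  by rewrite lerDl.
have term_ge0 s : (m <= s)%N -> 0 <= real_norm (taylor_term D s z) / (beta + s%:R).
  by move=> ms; rewrite pE divr_ge0 ?mulr_ge0 ?exprn_ge0 // ltW // b0.
rewrite /bohr_inequality -/r.
apply: lime_le.
  by apply: is_cvg_nneseries => s ms _; rewrite lee_fin term_ge0.
have : \forall N \near \oo, (m < N)%N by exists m.+1.
apply: filterS => N mN.
rewrite sumEFin lee_fin big_ltn // pE [m%:R + _]addrC.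
have -> : r ^+ m / (beta + m%:R) =
   r ^+ m * p m / (beta + m%:R) + r ^+ m * ((1 - p m) / (beta + m%:R)) by ring.
rewrite lerD2l.
apply: (@le_trans _ _ (r ^+ m * ((1 - p m) *
   (2 * (\sum_(m.+1 <= s < N) (beta + s%:R)^-1 * Rb ^+ (s - m)))))); last first.
  by rewrite ler_wpM2l ?exprn_ge0 // ler_wpM2l ?subr_ge0.
rewrite !mulr_sumr big_nat [leRHS]big_nat; apply: ler_sum => s /andP[ms _].
rewrite pE -[in r ^+ s](subnKC (ltnW ms)) exprD -!mulrA ler_wpM2l ?exprn_ge0 //.
have k0 : (0 < s - m)%N by rewrite subn_gt0.
have := pb _ k0; rewrite (subnKC (ltnW ms)) => pbs.
have rRb : r ^+ (s - m) <= Rb ^+ (s - m) by rewrite lerXn2r // nnegrE ltW.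
have ps : p s <= 2 * (1 - p m) by rewrite mulrBr mulr1 lerBrDl.
rewrite mulrCA; have -> : (1 - p m) * (2 * ((beta + s%:R)^-1 * Rb ^+ (s - m)))
  = (2 * (1 - p m)) * (Rb ^+ (s - m) / (beta + s%:R)) by ring.
apply: ler_pM => //; first by rewrite divr_ge0 ?exprn_ge0 // ltW // b0 // ltnW.
by rewrite ler_wpM2r // invr_ge0 ltW // b0 // ltnW.
Qed.

(** * The Bohr radius *)

(** The partial sums of the series in the equation of R(beta), with b = beta + m
    and the summation index shifted by m. *)
Definition bohr_sum (R : realType) (b r : R) (N : nat) : R :=
  \sum_(1 <= k < N) (b + k%:R)^-1 * r ^+ k.

Lemma bohr_sum_nondecreasing (R : realType) (b r : R) :
  0 < b -> 0 <= r -> {homo bohr_sum b r : N K / (N <= K)%N >-> N <= K}.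
Proof.
move=> b0 r0; apply/nondecreasing_seqP => N; rewrite /bohr_sum.
case: N => [|N]; first by rewrite !big_geq.
by rewrite [leRHS]big_nat_recr //= lerDl mulr_ge0 ?exprn_ge0 // invr_ge0 addr_ge0 // ltW.
Qed.

Lemma bohr_sum_is_cvg (R : realType) (b r : R) :
  0 < b -> 0 <= r < 1 -> cvgn (bohr_sum b r).
Proof.
move=> b0 r01; have /andP[r0 r1] := r01.
apply: nondecreasing_is_cvgn; first exact: bohr_sum_nondecreasing.
exists (b^-1 * (r ^+ 1 / (1 - r))) => _ [N _ <-].
apply: (@le_trans _ _ (b^-1 * \sum_(1 <= k < N) r ^+ k)); last first.
  by rewrite ler_wpM2l ?invr_ge0 ?(ltW b0) // geometric_tail_le.
rewrite mulr_sumr; apply: ler_sum => k _; rewrite ler_wpM2r ?exprn_ge0 //.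
by rewrite lef_pV2 ?posrE ?ltr_wpDr // lerDl.
Qed.

Lemma bohr_sum_le_lim (R : realType) (b r : R) (N : nat) :
  0 < b -> 0 <= r < 1 -> bohr_sum b r N <= limn (bohr_sum b r).
Proof.
move=> b0 r01; apply: nondecreasing_cvgn_le; last exact: bohr_sum_is_cvg.
by apply: bohr_sum_nondecreasing => //; case/andP: r01.
Qed.

(** The first term alone already increases by (y - x) / (b + 1), which keeps the
    inequality strict in the limit. *)
Lemma bohr_sum_lim_lt (R : realType) (b x y : R) :
  0 < b -> 0 <= x -> x < y -> y < 1 ->
  limn (bohr_sum b x) < limn (bohr_sum b y).
Proof.
move=> b0 x0 xy y1.
have cx : cvgn (bohr_sum b x) by apply: bohr_sum_is_cvg; rewrite ?x0 ?(lt_trans xy).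
have y0 : 0 <= y by rewrite ltW // (le_lt_trans x0).
have d0 : 0 < (b + 1)^-1 * (y - x) by rewrite mulr_gt0 ?invr_gt0 ?subr_gt0 // addr_gt0.
apply: (@lt_le_trans _ _ (limn (bohr_sum b x) + (b + 1)^-1 * (y - x))).
  by rewrite ltrDl.
rewrite -lerBrDr; apply: limr_le => //.
have : \forall N \near \oo, (1 < N)%N by exists 2%N.
apply: filterS => N N1; rewrite lerBrDr.
apply: le_trans (bohr_sum_le_lim N b0 _); last by rewrite y0.
rewrite /bohr_sum 2!(big_ltn N1) !expr1 addrAC -mulrDr [x + _]addrC subrK lerD2l.
apply: ler_sum => k _; rewrite ler_wpM2l ?invr_ge0 ?addr_ge0 ?(ltW b0) //.
by rewrite lerXn2r ?nnegrE // ltW.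
Qed.

Lemma exprn_lipschitz (R : realType) (k : nat) (x y rho : R) :
  0 <= x -> x <= y -> y <= rho ->
  y ^+ k.+1 - x ^+ k.+1 <= k.+1%:R * rho ^+ k * (y - x).
Proof.
move=> x0 xy yr; have y0 := le_trans x0 xy; have r0 := le_trans y0 yr.
elim: k => [|k IH]; first by rewrite !expr1 expr0 !mul1r.
have -> : y ^+ k.+2 - x ^+ k.+2 =
    y * (y ^+ k.+1 - x ^+ k.+1) + x ^+ k.+1 * (y - x).
  by rewrite !(exprS _ k.+1); ring.
have -> : k.+2%:R * rho ^+ k.+1 * (y - x) =
    rho * (k.+1%:R * rho ^+ k * (y - x)) + rho ^+ k.+1 * (y - x).
  by rewrite (natrD _ 1 k.+1) (exprS rho k); ring.
apply: lerD; last first.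
  by rewrite ler_wpM2r ?subr_ge0 // lerXn2r ?nnegrE // (le_trans xy).
by apply: ler_pM => //; rewrite subr_ge0 lerXn2r ?nnegrE.
Qed.

(** The k-th term grows by at most k / (b + k) rho^(k-1) (y - x), and
    k / (b + k) <= 1 leaves a geometric series. *)
Lemma bohr_sum_lim_lipschitz (R : realType) (b x y rho : R) :
  0 < b -> 0 <= x -> x <= y -> y <= rho -> rho < 1 ->
  limn (bohr_sum b y) - limn (bohr_sum b x) <= (y - x) / (1 - rho).
Proof.
move=> b0 x0 xy yr r1; have y0 := le_trans x0 xy; have r0 := le_trans y0 yr.
have y1 := le_lt_trans yr r1.
rewrite lerBlDr; apply: limr_le; first by apply: bohr_sum_is_cvg; rewrite ?y0.
apply: nearW => N.
apply: (@le_trans _ _ ((y - x) / (1 - rho) + bohr_sum b x N)); last first.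
  by rewrite lerD2l bohr_sum_le_lim // x0 (le_lt_trans xy).
rewrite -lerBlDr /bohr_sum -sumrB.
apply: (@le_trans _ _ (\sum_(1 <= k < N) (y - x) * rho ^+ k.-1)); last first.
  rewrite -mulr_sumr ler_wpM2l ?subr_ge0 //.
  case: N => [|N]; first by rewrite big_geq // invr_ge0 subr_ge0 ltW.
  rewrite big_add1 /= (le_trans (geometric_tail_le _ _ _)) ?r0 //.
  by rewrite expr0 mul1r.
rewrite big_nat [leRHS]big_nat; apply: ler_sum => -[//|k] _ /=.
rewrite -mulrBr ler_pdivrMl ?ltr_wpDr //.
apply: le_trans (exprn_lipschitz k x0 xy yr) _.
rewrite -mulrA [rho ^+ k * _]mulrC ler_wpM2r ?mulr_ge0 ?subr_ge0 ?exprn_ge0 //.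
by rewrite lerDr ltW.
Qed.

(** At r = 1 the sums dominate a multiple of the harmonic series, so some partial
    sum exceeds A; being polynomial in r, it still does for some r < 1. *)
Lemma ex_bohr_sum_gt (R : realType) (b A : R) :
  0 < b -> exists2 r, 0 < r < 1 & exists N, A < bohr_sum b r N.
Proof.
move=> b0.
have [N hN] : exists N, A < bohr_sum b 1 N.
  have nd : {homo series (@harmonic R) : n m / (n <= m)%N >-> n <= m}.
    by apply/nondecreasing_seqP => n; rewrite seriesSr lerDl harmonic_ge0.
  have /cvgryPgt/(_ (A * (b + 1))) := nondecreasing_dvgn_lt nd (@dvg_harmonic R).
  case=> N _ /(_ N (leqnn _)) hN; exists N.+1.
  have b1 : 0 < b + 1 by rewrite addr_gt0.
  move: hN; rewrite -ltr_pdivlMr // => /lt_le_trans; apply.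
  rewrite /bohr_sum /series /= big_add1 /= mulr_suml; apply: ler_sum => k _.
  rewrite expr1n mulr1 /harmonic /= -invfM lef_pV2 ?posrE ?mulr_gt0 ?ltr_wpDr //.
  rewrite mulrDr mulr1 lerD2r -[leLHS]mul1r ler_wpM2r ?(ltW b0) //.
  by rewrite ler1n.
have cv : (fun r => bohr_sum b r N) @ (1 : R)^'- --> bohr_sum b 1 N.
  apply: cvg_at_left_filter; rewrite /bohr_sum.
  apply: cvg_big => [|k _]; first exact: add_continuous.
  by apply: cvgMr; exact: exprn_continuous.
have : \forall r \near (1 : R)^'-, A < bohr_sum b r N by apply: cvgr_gt hN.
move=> near1; near (1 : R)^'- => r; exists r; last by exists N; near: r.
apply/andP; split; near: r; first by apply: nbhs_left_gt; exact: ltr01.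
exact: nbhs_left_lt.
Unshelve. all: by end_near.
Qed.

Lemma bohr_sum_lim_continuous (R : realType) (b rho : R) :
  0 < b -> 0 < rho < 1 ->
  {within `[0, rho], continuous (fun r => limn (bohr_sum b r))}.
Proof.
move=> b0 /andP[r0 r1].
have lip x y : 0 <= x -> x <= rho -> 0 <= y -> y <= rho ->
    `|limn (bohr_sum b x) - limn (bohr_sum b y)| <= `|x - y| / (1 - rho).
  wlog xy : x y / x <= y.
    move=> H; have [xy|/ltW yx] := leP x y; first exact: H.
    by move=> *; rewrite distrC [`|x - y|]distrC; exact: H.
  move=> x0 xr y0 yr; have y1 := le_lt_trans yr r1.
  rewrite distrC [`|x - y|]distrC !ger0_norm ?subr_ge0 //.
    exact: bohr_sum_lim_lipschitz.
  move: xy; rewrite le_eqVlt => /orP[/eqP->//|xy].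
  by rewrite ltW // bohr_sum_lim_lt.
apply/subspace_continuousP => x; rewrite /= in_itv /= => /andP[x0 xr].
apply/cvgrPdist_le => e e0.
have d0 : 0 < e * (1 - rho) by rewrite mulr_gt0 ?subr_gt0.
rewrite near_withinE; near=> y; rewrite /= in_itv /= => /andP[y0 yr].
apply: le_trans (lip _ _ x0 xr y0 yr) _; rewrite ler_pdivrMr ?subr_gt0 //.
Unshelve. all: by end_near.
Qed.

Lemma ex_bohr_radius (R : realType) (b : R) : 0 < b ->
  exists2 Rb, 0 < Rb < 1 & 2 * limn (bohr_sum b Rb) = b^-1.
Proof.
move=> b0; have [rho rho01 [N hN]] := @ex_bohr_sum_gt R b (b^-1 / 2) b0.
have /andP[rho0 rho1] := rho01.
have L0 : limn (bohr_sum b 0) = 0.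
  rewrite (_ : bohr_sum b 0 = fun=> 0) ?lim_cst //; apply/funext => K.
  by rewrite /bohr_sum big_nat big1 // => -[//|k] _; rewrite exprS mul0r mulr0.
have Lrho : b^-1 / 2 < limn (bohr_sum b rho).
  by apply: lt_le_trans hN _; rewrite bohr_sum_le_lim // ltW.
have b20 : 0 < b^-1 / 2 by rewrite divr_gt0 ?invr_gt0.
have := @IVT _ (fun r => limn (bohr_sum b r)) 0 rho (b^-1 / 2) (ltW rho0)
  (bohr_sum_lim_continuous b0 rho01).
rewrite L0 ge_min le_max (ltW b20) (ltW Lrho) orbT => /(_ isT)[c].
rewrite in_itv /= => /andP[c0 cr] Lc; exists c; last by rewrite Lc mulrC divfK.
rewrite (le_lt_trans cr) // andbT lt_neqAle c0 andbT eq_sym.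
by apply: contraTneq b20 => c_0; rewrite -Lc c_0 L0 ltxx.
Qed.

Lemma bohr_radius_eqE (R : realType) (m : nat) (beta r : R) :
  0 < beta + m%:R -> 0 <= r < 1 ->
  bohr_radius_eq m beta r <->
  2 * limn (bohr_sum (beta + m%:R) r) = (beta + m%:R)^-1.
Proof.
move=> b0 r01; rewrite /bohr_radius_eq.
have -> : limn (fun N => \sum_(m.+1 <= s < N) (beta + s%:R)^-1 * r ^+ (s - m))
    = limn (bohr_sum (beta + m%:R) r).
  apply/cvg_lim => //; rewrite -(cvg_shiftn m) /=.
  rewrite (_ : (fun n => _) = bohr_sum (beta + m%:R) r); first exact: bohr_sum_is_cvg.
  apply/funext => N; rewrite /bohr_sum -add1n big_addn addnK.
  by apply: eq_bigr => k _; rewrite addnK natrD -addrA [m%:R + _]addrC.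
by split => [/subr0_eq ->|->]; rewrite ?subrr.
Qed.

(** * Frechet derivatives of functions of one variable *)

Lemma norm_scale_const_mx1 (K : numFieldType) (c : K) :
  `|c *: (const_mx 1 : 'rV[K]_1)| = `|c|.
Proof.
apply/eqP; rewrite eq_le norm_mx_le => [|//|i j]; last by rewrite !mxE mulr1.
have := norm_coord_le (c *: (const_mx 1 : 'rV[K]_1)) ord0 ord0.
by rewrite !mxE mulr1.
Qed.

(** In one variable, D^s F(x)(v_1, ..., v_s) = F^(s)(x) v_1 ... v_s, and the
    first-order expansion of F^(s) at x is that of D^s F after factoring out the
    product of the v_i. *)
Lemma is_frechet_derivative_scalar (K : numFieldType) (f : nat -> K -> K) :
  (forall s x, `|x| < 1 -> is_derive x (1 : K) (f s) (f s.+1 x)) ->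
  forall (s : nat) (x : K), `|x| < 1 ->
  is_frechet_derivative (fun z : K => f 0%N z *: (const_mx 1 : 'rV[K]_1)) x
    (fun v : s.-tuple K => (f s x * \prod_(i < s) tnth v i) *: const_mx 1).
Proof.
move=> df; elim=> [|s IH] x x1 /=; first by rewrite big_ord0 mulr1.
split.
- move=> v i c u w; rewrite scalerA -scalerDl; congr (_ *: _).
  have E y : \prod_(j < s.+1)
      tnth [tuple (if k == i then y else tnth v k) | k < s.+1] j
      = y * \prod_(j < s.+1 | j != i) tnth v j.
    rewrite (bigD1 i) //= tnth_mktuple eqxx; congr (_ * _).
    by apply: eq_bigr => j ji; rewrite tnth_mktuple (negPf ji).
  by rewrite !E /GRing.scale /=; ring.
- by exists `|f s.+1 x| => v; rewrite norm_scale_const_mx1 normrM normr_prod.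
exists (fun y v => (f s y * \prod_(i < s) tnth v i) *: const_mx 1); split.
  have d0 : 0 < 1 - `|x| by rewrite subr_gt0.
  have /cvgrPdist_lt/(_ _ d0) := @cvg_id _ (nbhs x).
  apply: filterS => y xy; apply: IH.
  have -> : y = x - (x - y) by rewrite subKr.
  by rewrite (le_lt_trans (ler_normB _ _)) // addrC -ltrBrDr.
move=> e e0; have [dfx fx] := df s x x1.
have /eqaddoP/(_ _ e0) := derivable_nbhs dfx.
apply: filterS => h /= hh v.
have -> : \prod_(i < s.+1) tnth [tuple of h :: v] i = h * \prod_(i < s) tnth v i.
  rewrite big_ord_recl (tnth_nth 0) /=; congr (_ * _).
  by apply: eq_bigr => i _; rewrite !(tnth_nth 0).
rewrite -scalerBl -scalerBl norm_scale_const_mx1.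
have -> : f s (x + h) * \prod_(i < s) tnth v i - f s x * \prod_(i < s) tnth v i -
    f s.+1 x * (h * \prod_(i < s) tnth v i) =
    (f s (x + h) - f s x - f s.+1 x * h) * \prod_(i < s) tnth v i by ring.
rewrite normrM normr_prod ler_wpM2r ?prodr_ge0 //.
have -> : f s (x + h) - f s x - f s.+1 x * h =
    f s (h%:A + x) - (f s x + h *: f s.+1 x).
  by rewrite /GRing.scale /= mulr1 [h + x]addrC opprD addrA [h * _]mulrC.
by rewrite -fx; exact: hh.
Qed.

Lemma is_derive_horner (K : numFieldType) (p : {poly K}) (x : K) :
  is_derive x (1 : K) (horner p) (p^`()).[x].
Proof.
elim/poly_ind: p => [|p c IH].
  rewrite derivC horner0 (_ : horner 0 = cst 0); first exact: is_derive_cst.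
  by apply/funext => y; rewrite horner0.
rewrite (_ : horner _ = horner p * id + cst c); last first.
  by apply/funext => y; rewrite hornerMXaddC.
apply: is_derive_eq; rewrite derivMXaddC hornerD hornerMX /GRing.scale /=.
ring.
Qed.

Lemma is_derive_geometric (K : numFieldType) (a x : K) (s : nat) :
  1 - a * x != 0 ->
  is_derive x (1 : K) (fun z => s`!%:R * a ^+ s * (1 - a * z) ^- s.+1)
    (s.+1`!%:R * a ^+ s.+1 * (1 - a * x) ^- s.+2).
Proof.
move=> ax; pose g z : K := (1 - a * z)^-1.
have dl : is_derive x (1 : K) (fun z => 1 - a * z) (- a).
  rewrite (_ : (fun z => _) = cst 1 - a *: id); last by apply/funext.
  by apply: is_derive_eq; rewrite sub0r /GRing.scale /= mulr1.
have dg : is_derive x (1 : K) g (a * (1 - a * x) ^- 2).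
  have [dx vx] := dl; apply: DeriveDef; first exact: derivableV.
  by rewrite deriveV // vx /GRing.scale /= mulrNN mulrC.
rewrite (_ : (fun z => _) = (s`!%:R * a ^+ s) *: (g ^+ s.+1)); last first.
  apply/funext => z; rewrite -exprVn.
  change (s`!%:R * a ^+ s * g z ^+ s.+1 = s`!%:R * a ^+ s * (g ^+ s.+1) z).
  by rewrite exprfctE.
apply: is_derive_eq; rewrite /GRing.scale /= /g exprVn factS natrM !exprS expr0.
by field; rewrite ax expf_neq0.
Qed.

(** * Completeness of the complex numbers *)

Lemma norm_real_complex (R : rcfType) (x : R) : `|(x%:C)%C| = (`|x|%:C)%C.
Proof. by rewrite normc_def /= expr0n /= addr0 sqrtr_sqr. Qed.

Lemma norm_imaginary_unit (R : rcfType) : `|('i : R[i])%C| = 1.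
Proof. by rewrite normc_def /= expr0n /= expr1n add0r sqrtr1. Qed.

Lemma complex_cauchy_cvg (R : realType) (G : set_system R[i]) :
  ProperFilter G -> cauchy G -> cvg G.
Proof.
move=> PG /cauchyP cG.
have part (h : R[i] -> R) :
    (forall x y, (`|h x - h y|%:C)%C <= `|x - y|) -> cvg (h @ G).
  move=> hh; apply: cauchy_cvg; apply/cauchyP => e e0.
  have /cG[x Gx] : 0 < (e%:C)%C :> R[i] by rewrite ltcR.
  exists (h x); change (G (h @^-1` ball (h x) e)).
  apply: filterS Gx => y; rewrite -!ball_normE /= => xy.
  by have := le_lt_trans (hh x y) xy; rewrite ltcR.
have ReP (w : R[i]) : (`|complex.Re w|%:C)%C <= `|w| by exact: normc_ge_Re.
have ImP (w : R[i]) : (`|complex.Im w|%:C)%C <= `|w|.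
  by have := normc_ge_Re (w * 'i%C); rewrite ReiNIm normrN normrM norm_imaginary_unit mulr1.
have /cvg_ex[p /cvgrPdist_le cp] : cvg (@complex.Re R @ G).
  by apply: part => -[x1 x2] [y1 y2]; exact: ReP (Complex _ _).
have /cvg_ex[q /cvgrPdist_le cq] : cvg (@complex.Im R @ G).
  by apply: part => -[x1 x2] [y1 y2]; exact: ImP (Complex _ _).
apply/cvg_ex; exists (p +i* q)%C; apply/cvgrPdist_le => e e0.
have eE := gt0_complexE e0.
have e20 : 0 < complex.Re e / 2 by rewrite divr_gt0 // -ltcR -eE.
near=> w; rewrite [X in `|X|]complexE (le_trans (ler_normD _ _)) //.
rewrite normrM norm_imaginary_unit mul1r !norm_real_complex -rmorphD eE lecR.
have -> : complex.Re ((p +i* q)%C - w) = p - complex.Re w by case: (w).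
have -> : complex.Im ((p +i* q)%C - w) = q - complex.Im w by case: (w).
rewrite [complex.Re e]splitr lerD //; near: w; [exact: cp | exact: cq].
Unshelve. all: by end_near.
Qed.

(** The complex numbers are the Banach space on which the extremal maps live. *)
HB.instance Definition _ (R : realType) :=
  Uniform_isComplete.Build R[i] (@complex_cauchy_cvg R).

(** * The extremal maps *)

(** The polynomial part of z^m (a - z) / (1 - a z) in its partial fraction
    decomposition; the remaining part is a multiple of 1 / (1 - a z). *)
Definition blaschke_poly (K : numFieldType) (m : nat) (a : K) : {poly K} :=
  a^-1 *: 'X^m - ((a - a^-1) * a ^- m) *: \sum_(k < m) a ^+ k *: 'X^k.

(** The s-th derivative of z^m (a - z) / (1 - a z). Partial fractions make it
    explicit for all s at once. *)
Definition blaschke_derivn (K : numFieldType) (m : nat) (a : K) (s : nat)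
    (z : K) : K :=
  ((blaschke_poly m a)^`(s)).[z]
    + (a - a^-1) * a ^- m * (s`!%:R * a ^+ s * (1 - a * z) ^- s.+1).

(** The Taylor coefficients of z^m (a - z) / (1 - a z) from order m on; the lower
    ones vanish. *)
Definition blaschke_coef (K : numFieldType) (m : nat) (a : K) (s : nat) : K :=
  if s == m then a else (a - a^-1) * a ^+ (s - m).

Lemma is_derive_blaschke (K : numFieldType) (m : nat) (a : K) (s : nat) (z : K) :
  1 - a * z != 0 ->
  is_derive z (1 : K) (blaschke_derivn m a s) (blaschke_derivn m a s.+1 z).
Proof.
move=> az.
have H (q : {poly K}) (c dg : K) (g : K -> K) : is_derive z (1 : K) g dg ->
    is_derive z (1 : K) (fun y => q.[y] + c * g y) (q^`().[z] + c * dg).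
  move=> gdg; exact: (is_deriveD (is_derive_horner q z) (is_deriveZ c gdg)).
by rewrite /blaschke_derivn derivnS; exact/H/is_derive_geometric.
Qed.

Lemma blaschkeE (K : numFieldType) (m : nat) (a z : K) :
  a != 0 -> 1 - a * z != 0 ->
  blaschke_derivn m a 0 z = z ^+ m * ((a - z) / (1 - a * z)).
Proof.
move=> a0 az; rewrite /blaschke_derivn /blaschke_poly derivn0.
rewrite hornerD hornerN !hornerZ hornerXn horner_sum.
have -> : \sum_(k < m) (a ^+ k *: 'X^k).[z] = (1 - (a * z) ^+ m) / (1 - a * z).
  apply: (mulIf az); rewrite divfK // -[1 - (a * z) ^+ m]opprB subrX1.
  rewrite -[RHS]mulNr opprB mulrC; congr (_ * _).
  by apply: eq_bigr => k _; rewrite hornerZ hornerXn exprMn.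
rewrite fact0 expr0 exprMn expr1.
have am : a ^+ m != 0 by rewrite expf_neq0.
by field; rewrite a0 az am.
Qed.

Lemma blaschke_derivn0 (K : numFieldType) (m : nat) (a : K) (s : nat) :
  a != 0 -> (m <= s)%N ->
  s`!%:R^-1 * blaschke_derivn m a s 0 = blaschke_coef m a s.
Proof.
move=> a0 ms; rewrite /blaschke_derivn horner_coef0 coef_derivn addn0 ffactnn.
have fs k : (k`!%:R : K) != 0 by rewrite pnatr_eq0 -lt0n fact_gt0.
have -> : (blaschke_poly m a)`_s = if s == m then a^-1 else 0.
  rewrite /blaschke_poly coefB !coefZ coefXn coef_sum big1 ?mulr0 ?subr0.
    by case: eqP; rewrite ?mulr1 ?mulr0.
  by move=> k _; rewrite coefZ coefXn gtn_eqF ?mulr0 // (leq_trans _ ms).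
have -> : a ^+ s = a ^+ m * a ^+ (s - m) by rewrite -exprD subnKC.
have am : a ^+ m != 0 by rewrite expf_neq0.
rewrite /blaschke_coef mulr0 subr0 expr1n invr1 mulr1 -mulr_natl.
case: eqP => [->|_]; last by field; rewrite ?a0 ?am ?fs.
by rewrite subnn expr0; field; rewrite ?a0 ?am ?fs.
Qed.

(** The Moebius factor maps the disc into itself because
    |1 - a z|^2 - |a - z|^2 = (1 - a^2) (1 - |z|^2). *)
Lemma blaschke_lt1 (C : numClosedFieldType) (m : nat) (a z : C) :
  0 < a < 1 -> `|z| < 1 -> `|z ^+ m * ((a - z) / (1 - a * z))| < 1.
Proof.
move=> /andP[a0 a1] z1; have na : `|a| = a by rewrite ger0_norm // ltW.
have az1 : `|a * z| < 1.
  by rewrite normrM na (le_lt_trans _ a1) // ler_piMr // ltW.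
have az : 1 - a * z != 0.
  by apply: contraTneq az1 => /subr0_eq <-; rewrite normr1 ltxx.
rewrite normrM (@le_lt_trans _ _ (`|(a - z) / (1 - a * z)|)) //.
  by rewrite ler_piMl // normrX exprn_ile1 // ltW.
rewrite normf_div ltr_pdivrMr ?normr_gt0 // mul1r.
rewrite -(@ltr_pXn2r _ 2) ?nnegrE // !normCK !rmorphB rmorph1 rmorphM /=.
rewrite (geC0_conj (ltW a0)) -subr_gt0.
have -> : (1 - a * z) * (1 - a * z^*) - (a - z) * (a - z^*) =
    (1 - a ^+ 2) * (1 - z * z^*) by ring.
by rewrite -normCK mulr_gt0 // subr_gt0 exprn_ilt1 // ltW.
Qed.

Definition blaschke_map (K : numFieldType) (m : nat) (a z : K) : 'rV[K]_1 :=
  blaschke_derivn m a 0 z *: const_mx 1.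

Definition blaschke_diff (K : numFieldType) (m : nat) (a : K) (s : nat)
    (v : s.-tuple K) : 'rV[K]_1 :=
  (blaschke_derivn m a s 0 * \prod_(i < s) tnth v i) *: const_mx 1.

Lemma taylor_term_blaschke (K : numFieldType) (m : nat) (a : K) (s : nat)
    (z : K) : a != 0 -> (m <= s)%N ->
  taylor_term (@blaschke_diff K m a) s z
  = (blaschke_coef m a s * z ^+ s) *: const_mx 1.
Proof.
move=> a0 ms; rewrite /taylor_term /blaschke_diff scalerA mulrA blaschke_derivn0 //.
congr ((_ * _) *: _); under eq_bigr do rewrite tnth_mktuple.
by rewrite prodr_const card_ord.
Qed.

(** A geometric sum, with the remainder in closed form. *)
Lemma blaschke_partial_sum (K : numFieldType) (m : nat) (a z : K) (N : nat) :
  a != 0 -> 1 - a * z != 0 -> (m < N)%N ->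
  blaschke_coef m a m * z ^+ m
    + \sum_(m.+1 <= s < N) blaschke_coef m a s * z ^+ s
  = blaschke_derivn m a 0 z
    - (a - a^-1) * a ^- m / (1 - a * z) * (a * z) ^+ N.
Proof.
move=> a0 az mN; have am : a ^+ m != 0 by rewrite expf_neq0.
elim: N mN => // N IH; rewrite ltnS leq_eqVlt => /orP[/eqP <-|mN].
  rewrite big_geq // addr0 blaschkeE // /blaschke_coef eqxx exprS exprMn.
  by field; rewrite a0 az am.
rewrite big_nat_recr //= addrA IH // /blaschke_coef gtn_eqF //.
have -> : (a - a^-1) * a ^+ (N - m) * z ^+ N = (a - a^-1) * a ^- m * (a * z) ^+ N.
  rewrite exprMn; have -> : a ^+ N = a ^+ m * a ^+ (N - m).
      by rewrite -exprD subnKC // ltnW.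
    by field; rewrite a0 am.
by rewrite exprS; field; rewrite a0 az am.
Qed.

Lemma blaschke_bohr_mapping (R : realType) (m : nat) (a : R) : 0 < a < 1 ->
  @bohr_mapping R m 1 R[i] (blaschke_map m (a%:C)%C)
    (@blaschke_diff R[i] m (a%:C)%C).
Proof.
move=> /andP[a0 a1]; set A : R[i] := (a%:C)%C.
have A01 : 0 < A < 1 by rewrite ltcR a0 -[1]/((1%:C)%C) ltcR.
have /andP[A0 A1] := A01.
have An0 : A != 0 by rewrite gt_eqF.
have nA : `|A| = A by rewrite ger0_norm // ltW.
have AzN (z : R[i]) : `|z| < 1 -> `|A * z| < 1.
  by move=> z1; rewrite normrM nA (le_lt_trans _ A1) // ler_piMr // ltW.
have Az (z : R[i]) : `|z| < 1 -> 1 - A * z != 0.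
  by move=> /AzN; apply: contraTneq => /subr0_eq <-; rewrite normr1 ltxx.
have df s (z : R[i]) : `|z| < 1 ->
    is_derive z (1 : R[i]) (blaschke_derivn m A s) (blaschke_derivn m A s.+1 z).
  by move=> /Az; exact: is_derive_blaschke.
have TE := taylor_term_blaschke _ An0.
split.
- move=> z z1; apply: differentiableZl.
  by apply/derivable1_diffP; case: (df 0%N z z1).
- move=> z z1; apply: subset_closure => j.
  rewrite /blaschke_map !mxE mulr1 blaschkeE ?Az //.
  exact: blaschke_lt1.
- move=> s; apply: (is_frechet_derivative_scalar df).
  by rewrite normr0 ltr01.
- move=> z z1; apply/cvgrPdist_le => e e0.
  have := AzN z z1; rewrite real_normE -[1]/((1%:C)%C) ltcR => q1.
  set q := real_norm (A * z) in q1.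
  have q0 : 0 <= q by exact: real_norm_ge0.
  set B := (A - A^-1) * A ^- m / (1 - A * z).
  have eE := gt0_complexE e0.
  have e0' : 0 < complex.Re e by rewrite -ltcR -eE.
  have : (fun N => real_norm B * q ^+ N) @ \oo --> (real_norm B * 0).
    by apply: cvgMr; apply: cvg_expr; rewrite ger0_norm.
  rewrite mulr0 => /cvgrPdist_le/(_ _ e0').
  have : \forall N \near \oo, (m < N)%N by exists m.+1.
  apply: filterS2 => N mN; rewrite sub0r normrN => hN.
  have -> : \sum_(m.+1 <= s < N) taylor_term (@blaschke_diff R[i] m A) s z =
      (\sum_(m.+1 <= s < N) blaschke_coef m A s * z ^+ s) *: const_mx 1.
    rewrite scaler_suml; apply: eq_big_nat => s /andP[ms _].
    by rewrite TE // ltnW.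
  rewrite TE //.
  rewrite -scalerDl blaschke_partial_sum ?Az // /blaschke_map -scalerBl.
  rewrite norm_scale_const_mx1 subKr -/B normrM normrX !real_normE -/q.
  by rewrite -rmorphXn -rmorphM eE lecR (le_trans (ler_norm _)).
- exists A => z z1; rewrite TE // norm_scale_const_mx1 normrM normrX z1 expr1n mulr1.
  by rewrite /blaschke_coef eqxx.
move=> j z _; rewrite TE // norm_scale_const_mx1.
by rewrite !mxE mulr1.
Qed.

(** * Sharpness and conclusion *)

(** At a = 1 the conclusion is the hypothesis; both sides are polynomial in a, so
    it persists for a slightly below 1. *)
Lemma ex_blaschke_parameter (R : realType) (b r : R) (N : nat) :
  b^-1 < 2 * bohr_sum b r N ->
  exists2 a, 0 < a < 1 & a / b < (1 + a) * bohr_sum b (a * r) N.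
Proof.
move=> hN; pose g (a : R) := (1 + a) * bohr_sum b (a * r) N - a * b^-1.
have cg : g @ (1 : R)^'- --> g 1.
  apply: cvg_at_left_filter; apply: cvgB; last by apply: cvgMl; exact: cvg_id.
  apply: cvgM; first by apply: cvgD; [exact: cvg_cst | exact: cvg_id].
  apply: cvg_big => [|k _]; first exact: add_continuous.
  apply: cvgMr; apply: (@cvg_comp _ _ _ (fun a : R => a * r) (fun x : R => x ^+ k)).
    by apply: cvgMl; exact: cvg_id.
  exact: exprn_continuous.
have g1 : 0 < g 1 by rewrite /g !mul1r subr_gt0 -(natrD _ 1 1).
have near1 : \forall x \near (1 : R)^'-, 0 < g x by exact: cvgr_gt g1.
near (1 : R)^'- => a; exists a; last first.
  by rewrite -subr_gt0 -/(g a); near: a.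
apply/andP; split; near: a; first by apply: nbhs_left_gt; exact: ltr01.
exact: nbhs_left_lt.
Unshelve. all: by end_near.
Qed.

(** The moduli of the coefficients are a, and then (1/a - a) a^k for k >= 1. So
    the partial sums divided by r^m are
    a/b + (1 - a)/a (1 + a) bohr_sum b (a r) N, and the hypothesis makes this
    larger than a/b + (1 - a)/b = 1/b. *)
Lemma blaschke_not_bohr (R : realType) (m : nat) (beta a r : R) (N : nat) :
  - m%:R < beta -> 0 < a < 1 -> 0 < r ->
  a / (beta + m%:R) < (1 + a) * bohr_sum (beta + m%:R) (a * r) N ->
  ~ @bohr_inequality R m 1 beta R[i] (@blaschke_diff R[i] m (a%:C)%C) (r%:C)%C.
Proof.
move=> hbeta /andP[a0 a1] r0 hN; set A : R[i] := (a%:C)%C.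
set b := beta + m%:R in hN *.
have b0 s : (m <= s)%N -> 0 < beta + s%:R by exact: addr_natr_gt0.
have bm0 : 0 < b by exact: b0.
have An0 : A != 0 by rewrite gt_eqF // ltcR.
have nr : real_norm ((r%:C)%C : R[i]) = r.
  by rewrite /real_norm norm_real_complex /= gtr0_norm.
have ia0 : 0 < a^-1 - a by rewrite subr_gt0 (lt_trans a1) // invf_gt1.
have pE s : (m <= s)%N -> real_norm (taylor_term (@blaschke_diff R[i] m A) s (r%:C)%C)
    = (if s == m then a else (a^-1 - a) * a ^+ (s - m)) * r ^+ s.
  move=> ms; rewrite taylor_term_blaschke // /real_norm norm_scale_const_mx1.
  have -> : blaschke_coef m A s =
      ((if s == m then a else (a - a^-1) * a ^+ (s - m))%:C)%C.
    rewrite /blaschke_coef; case: eqP => // _.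
    by rewrite rmorphM rmorphB fmorphV rmorphXn.
  rewrite -rmorphXn -rmorphM norm_real_complex /= normrM normrX (gtr0_norm r0).
  case: eqP => _; first by rewrite gtr0_norm.
  by rewrite normrM normrX (gtr0_norm a0) distrC (gtr0_norm ia0).
rewrite /bohr_inequality nr => le.
have term_ge0 s : (m <= s)%N -> true ->
    (0 <= (real_norm (taylor_term (@blaschke_diff R[i] m A) s (r%:C)%C)
      / (beta + s%:R))%:E)%E.
  move=> ms _; rewrite lee_fin pE // divr_ge0 ?(ltW (b0 _ ms)) //.
  rewrite mulr_ge0 ?exprn_ge0 ?(ltW r0) //; case: eqP => _; rewrite ?(ltW a0) //.
  by rewrite mulr_ge0 ?exprn_ge0 ?(ltW ia0) ?(ltW a0).
have := le_trans (nneseries_lim_ge (N + m) term_ge0) le.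
case: N hN => [|N] hN.
  by move: hN; rewrite /bohr_sum big_geq // mulr0 ltNge divr_ge0 ?(ltW a0) ?(ltW bm0).
have mN : (m < N.+1 + m)%N by rewrite addSn ltnS leq_addl.
rewrite sumEFin lee_fin [m%:R + _]addrC -/b big_ltn // pE // eqxx.
have -> : \sum_(m.+1 <= s < N.+1 + m)
    real_norm (taylor_term (@blaschke_diff R[i] m A) s (r%:C)%C) / (beta + s%:R)
    = r ^+ m * ((a^-1 - a) * bohr_sum b (a * r) N.+1).
  rewrite /bohr_sum -[m.+1]add1n big_addn addnK !mulr_sumr.
  apply: eq_big_nat => k /andP[k0 _].
  rewrite pE ?leq_addl // -[X in _ == X]add0n eqn_add2r gtn_eqF // addnK.
  rewrite exprMn exprD natrD -addrA [m%:R + _]addrC addrA; ring.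
rewrite -/b -[a * r ^+ m]mulrC -mulrA -mulrDr ler_pM2l ?exprn_gt0 //.
set S := bohr_sum b _ _ in hN *.
have -> : (a^-1 - a) * S = (1 - a) / a * ((1 + a) * S).
  by field; rewrite gt_eqF.
move=> h; have k0 : 0 < (1 - a) / a by rewrite divr_gt0 // subr_gt0.
have : a / b + (1 - a) / a * (a / b) < b^-1.
  by apply: lt_le_trans h; rewrite ltrD2l ltr_pM2l.
have -> : a / b + (1 - a) / a * (a / b) = b^-1 by field; rewrite !gt_eqF.
by rewrite ltxx.
Qed.

Theorem theorem2p2 (R : realType) (m : nat) (beta : R)
    (hbeta : - m%:R < beta) :
  exists Rb : R,
    [/\ 0 < Rb < 1 /\ bohr_radius_eq m beta Rb,
        forall r : R, 0 < r < 1 -> bohr_radius_eq m beta r -> r = Rb,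
        forall (X : completeNormedModType R[i]) (n : nat)
          (F : X -> 'rV[R[i]]_n)
          (D : forall s : nat, s.-tuple X -> 'rV[R[i]]_n),
          (exists x : X, x != 0) -> (0 < n)%N -> bohr_mapping m F D ->
          forall z : X, `|z| < 1 -> real_norm z <= Rb ->
            bohr_inequality m beta D z
      & forall R' : R, Rb < R' < 1 ->
        exists (X : completeNormedModType R[i]) (n : nat)
          (F : X -> 'rV[R[i]]_n)
          (D : forall s : nat, s.-tuple X -> 'rV[R[i]]_n) (z : X),
          [/\ (exists x : X, x != 0) /\ (0 < n)%N, bohr_mapping m F D,
              `|z| < 1, real_norm z <= R' & ~ bohr_inequality m beta D z]].
Proof.
have b0 : 0 < beta + m%:R by exact: addr_natr_gt0 hbeta _.
have [Rb Rb01 RbE] := ex_bohr_radius b0; have /andP[Rb0 Rb1] := Rb01.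
have Rb01' : 0 <= Rb < 1 by rewrite ltW.
exists Rb; split.
- by split=> //; apply/bohr_radius_eqE.
- move=> r /andP[r0 r1] /bohr_radius_eqE; rewrite (ltW r0) => /(_ b0 r1) rE.
  have LE : limn (bohr_sum (beta + m%:R) r) = limn (bohr_sum (beta + m%:R) Rb).
    by apply: (@mulfI _ 2); rewrite ?pnatr_eq0 // rE RbE.
  case: (ltgtP r Rb) => // [rR|Rr].
    by have := bohr_sum_lim_lt b0 (ltW r0) rR Rb1; rewrite LE ltxx.
  by have := bohr_sum_lim_lt b0 (ltW Rb0) Rr r1; rewrite LE ltxx.
- move=> X n F D x0 n0 FD z _ zRb.
  apply: (bohr_inequality_of_radius hbeta Rb0 _ x0 n0 FD zRb) => N.
  rewrite -RbE ler_pM2l // (le_trans _ (bohr_sum_le_lim (N - m) b0 Rb01')) //.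
  rewrite /bohr_sum -{1}[m.+1]add1n big_addn.
  by apply: ler_sum => k _; rewrite addnK natrD -addrA [m%:R + _]addrC.
move=> R' /andP[RbR' R'1]; have R'0 := lt_trans Rb0 RbR'.
have [N hN] : exists N, (beta + m%:R)^-1 < 2 * bohr_sum (beta + m%:R) R' N.
  have lt := bohr_sum_lim_lt b0 (ltW Rb0) RbR' R'1.
  have cv : cvgn (bohr_sum (beta + m%:R) R') by apply: bohr_sum_is_cvg; rewrite ?ltW.
  have : \forall N \near \oo,
      limn (bohr_sum (beta + m%:R) Rb) < bohr_sum (beta + m%:R) R' N.
    exact: cvgr_gt cv _ lt.
  by case=> N _ /(_ N (leqnn _)) /= hN; exists N; rewrite -RbE ltr_pM2l.
have [a a01 ha] := ex_blaschke_parameter hN.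
exists R[i], 1%N, (blaschke_map m (a%:C)%C), (@blaschke_diff R[i] m (a%:C)%C), (R'%:C)%C.
split.
- by split=> //; exists 1; rewrite oner_eq0.
- exact: blaschke_bohr_mapping.
- by rewrite norm_real_complex gtr0_norm // -[1]/((1%:C)%C) ltcR.
- by rewrite /real_norm norm_real_complex /= gtr0_norm.
exact: blaschke_not_bohr ha.
Qed.
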